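(* Under the standing assumptions described in the context, let $A(t,\lambda)$ be the solution of $\dot A=AX^G(t,\lambda)$, $A(0)=I_3$, and let $Z(t,\lambda)\in q(D)$ be the sufficiently $CS$ function with $A(t,\lambda)=e^{Z(t,\lambda)}$ for $t\in[0,\infty)$ and $\lambda\ge0$ small. Then $$X(\lambda)=\frac{|\omega_\lambda|}{2\pi}\,Z\!\left(\frac{2\pi}{|\omega_\lambda|},\lambda\right),\qquad \lambda\ge0\text{ small},$$ is the unique sufficiently $CS$ branch such that $\frac{2\pi}{|\omega_\lambda|}X(\lambda)\in q(D)$ for $\lambda\ge0$ small, $\overrightarrow{X(\lambda)}$ is a primary frequency vector of $\mathbf\Phi(t,u_\lambda,\lambda)$ for $\lambda>0$ small, and $\mathbf\Phi\!\left(\frac{2\pi}{|\omega_{bif}|},u_0,0\right)=e^{X(0)\frac{2\pi}{|\omega_{bif}|}}u_0$.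
   Context: Regularity conventions. ''Sufficiently smooth'' means of class $C^m$ with $m\ge1$ as large as required, the data being assumed $C^M$ with $M$ large enough. A function $Y(x,\lambda)$, $\lambda\in[0,\lambda_0)$, with values in a smooth manifold is called sufficiently $CS$ if $(x,\epsilon)\mapsto Y(x,\epsilon^2)$ is sufficiently smooth for $\epsilon\in[0,\sqrt{\lambda_0})$. The equation. Let $r>0$, $\mathbf S^2\subset\mathbb R^3$ the unit sphere, $N\ge1$, $D_{\rm diff}=\mathrm{diag}(d_1,\dots,d_N)$ with $d_i\ge0$, $\Delta_S$ the Laplace-Beltrami operator on $r\mathbf S^2$, $F:\mathbb R^N\times\mathbb R\to\mathbb R^N$ of class $C^{k+2}$, $3\le k\le\infty$, with $F(0,\lambda)=0$. Consider $\partial_t u=D_{\rm diff}\Delta_S u+F(u,\lambda)$ on $r\mathbf S^2$. Let $\mathbf Y=L^2(r\mathbf S^2,\mathbb R^N)$ if all $d_i>0$ and $\mathbf Y=H^2(r\mathbf S^2,\mathbb R^N)$ otherwise; let $\alpha\in(\frac12,1)$ and let $\mathbf Y^\alpha$ be the domain of $(I-D_{\rm diff}\Delta_S)^\alpha$. The equation defines a sufficiently smooth local semiflow $\mathbf\Phi(t,u,\lambda)$ on $\mathbf Y^\alpha$, equivariant under the action $(Au)(x)=u(A^{-1}x)$, $A\in SO(3)$. $so(3)$ is the space of real antisymmetric $3\times3$ matrices; $I_3,O_3$ are the identity and zero matrices; for $Y\in so(3)$, $\overrightarrow Y\in\mathbb R^3$ is the vector with $Yw=\overrightarrow Y\times w$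 for all $w$ (so $\overrightarrow{[X,Y]}=\overrightarrow X\times\overrightarrow Y$) and $|Y|=\|\overrightarrow Y\|$. Standing assumptions. $u_0\in\mathbf Y^\alpha$ has trivial isotropy $\{I_3\}$ and is a relative equilibrium, not an equilibrium, at $\lambda=0$: $\mathbf\Phi(t,u_0,0)=e^{X_0t}u_0$, $X_0\in so(3)$, $X_0\ne O_3$. With $L=D_{\rm diff}\Delta_S+D_uF(u_0,0)-X_0$ ($X_0$ acting as infinitesimal generator), assume $\sigma(L)\cap\{\mathrm{Re}\,z\ge0\}$ is a spectral set with spectral projection $P_*$, $\dim R(P_* )=5$, and $|e^{Lt}|_{R(1-P_* )}|\le Ce^{-\beta_0t}$ for some $C,\beta_0>0$. Then (equivariant center manifold reduction), with $V_*$ the orthogonal complement of $T_{u_0}(SO(3)u_0)$ in $R(P_* )$, there are a center manifold $M^{cu}_{u_0}(\lambda)$ diffeomorphic to $SO(3)\times V_*$ via $(A,q)\mapsto A\Psi(q)$ ($\Psi$ a local chart) and sufficiently smooth $X_G:V_*\times\mathbb R\to so(3)$, $X_N:V_*\times\mathbb R\to V_*$ with $X_G(0,0)=X_0$, $X_N(0,0)=0$, such that solutions of $\dot A=AX_G(q,\lambda)$, $\dot q=X_N(q,\lambda)$ correspond to solutions on $M^{cu}_{u_0}(\lambda)$ for $|\lambda|$ small. A supercritical Hopf bifurcation occurs in $\dot q=X_N(q,\lambda)$ at $q=0,\lambda=0$: $X_N(0,\lambda)=0$ for $|\lambda|$ small; $D_qX_N(0,\lambda)$ has eigenvalues $\alpha(\lambda)\pm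 i(\omega_{bif}+\beta(\lambda))$, $\alpha(0)=\beta(0)=0$, $\alpha'(0)>0$, $\omega_{bif}\neq 0$; and a stable periodic solution $q(t,\lambda)=\sqrt\lambda\,r(t,\lambda)=O(\sqrt\lambda)$, sufficiently $CS$, of period $\frac{2\pi}{|\omega_\lambda|}$, $\omega_\lambda=\omega_{bif}+O(\lambda)$, bifurcates for $\lambda>0$ small; $q(t,0)=0$. $X^G(t,\lambda)=X_G(q(t,\lambda),\lambda)$ for $\lambda>0$, and $X^G(t,0)=X_0$, for $t\in[0,\infty)$; it is sufficiently $CS$ and $\frac{2\pi}{|\omega_\lambda|}$-periodic in $t$. The branch of solutions is $\mathbf\Phi(t,u_\lambda,\lambda)=A(t,\lambda)\Psi(q(t,\lambda))$ with $u_\lambda=\Psi(q(0,\lambda))$; for $\lambda>0$ small it is a modulated rotating wave of relative period $T(\lambda)=\frac{2\pi}{|\omega_\lambda|}$ or a $T(\lambda)$-periodic solution. Primary frequency vectors. $\overrightarrow X$ is a primary frequency vector of $\mathbf\Phi(t,u_\lambda,\lambda)$ if $\mathbf\Phi(T(\lambda),u_\lambda,\lambda)=e^{XT(\lambda)}u_\lambda$, equivalently $A(T(\lambda),\lambda)=e^{XT(\lambda)}$, where $T(\lambda)$ is the least $t>0$ with $\mathbf\Phi(t,u_\lambda,\lambda)\in SO(3)u_\lambda$ (in the periodic case any $\overrightarrow X$ with $|X|=\frac{2k\pi}{T(\lambda)}$, $k\in\mathbb Z$, is one). The set $q(D)$. The north hemisphere of $\mathbf S^2$ is $\{(x,y,z)\in\mathbf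 S^2\mid z>0,\text{ or }z=0,\ x\in[-1,1),\ y\in[0,1]\}$, the south hemisphere is its complement. $D$ is the quotient of $\{Y\in so(3)\mid|Y|\le\pi\}$ obtained by identifying $Y$ with $-Y$ when $|Y|=\pi$; it is a model of $\mathbb{R}P^3$, and $[Y]\mapsto e^{Y}$ is a diffeomorphism $D\to SO(3)$. The map $q$ (not to be confused with the variable $q\in V_*$) is $q([Y])=Y$ if $Y=O_3$ or if $\frac1{|Y|}\overrightarrow Y$ and $\frac1{|X_0|}\overrightarrow{X_0}$ are in the same hemisphere, and $q([Y])=\left(1-\frac{2\pi}{|Y|}\right)Y$ otherwise; one has $e^{q([Y])}=e^{Y}$. Elements of norm $2\pi$ are identified with $O_3$, and $q$ is regarded as a smooth map onto $q(D)$, so $q(D)$ carries the smooth structure transported from $D$; regularity of $q(D)$-valued functions (and of $X(\lambda)$ via $\frac{2\pi}{|\omega_\lambda|}X(\lambda)\in q(D)$) is with respect to this structure. *)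

(* Defs.v *)
From HB Require Import structures.
From mathcomp Require Import all_boot all_order all_algebra.
From mathcomp Require Import all_classical all_reals all_analysis.
From mathcomp Require Import complex.

Set Implicit Arguments.
Unset Strict Implicit.
Unset Printing Implicit Defensive.

Import Order.TTheory GRing.Theory Num.Theory.
Import numFieldNormedType.Exports.

Local Open Scope classical_set_scope.
Local Open Scope ring_scope.

(* [Cm m U f]: f is of class C^m on the open set U.  The induction is on the
   tangent map (x, v) |-> Df(x)v.  Between finite-dimensional spaces this is the
   usual class C^m; between Banach spaces Frechet-C^m implies it and it implies
   Frechet-C^(m-1), so that "sufficiently smooth" has the same meaning. *)
Fixpoint Cm (R : realType) (m : nat) :
    forall E F : normedModType R, set E -> (E -> F) -> Prop :=
  match m with
  | 0 => fun E F U f => forall x, U x -> {for x, continuous f}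
  | m'.+1 => fun E F U f =>
      (forall x, U x -> differentiable f x) /\
      @Cm R m' (E * E)%type F (U `*` setT) (fun p => 'd f (p.1) p.2)
  end.
Arguments Cm {R} m {E F} U f.

(* C^k with k in {0, 1, ...} \cup {oo}, where [None] is k = oo. *)
Definition Cclass (R : realType) (k : option nat) (E F : normedModType R)
    (U : set E) (f : E -> F) : Prop :=
  forall m : nat, (if k is Some k' then m <= k' else true)%N -> Cm m U f.
Arguments Cclass {R} k {E F} U f.

Section Smoothness.
Context {R : realType}.

(* C^m on a set that need not be open (a submanifold, or a half-open interval):
   local C^m extensions to open sets. *)
Definition Cm_on (m : nat) (E F : normedModType R) (S : set E) (f : E -> F) :=
  forall x, S x -> exists (U : set E) (g : E -> F),
    [/\ open U, U x, Cm m U g & forall y, U y -> S y -> f y = g y].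

Definition diffeo_on (m : nat) (E F : normedModType R) (S : set E) (S' : set F)
    (f : E -> F) :=
  exists g : F -> E,
    [/\ forall x, S x -> S' (f x) /\ g (f x) = x,
        forall y, S' y -> S (g y) /\ f (g y) = y,
        Cm_on m S f & Cm_on m S' g].

(* The parameters epsilon = sqrt(lambda), for lambda in [0, lam0). *)
Definition eps_dom (lam0 : R) : set R :=
  [set eps | 0 <= eps /\ eps < Num.sqrt lam0].

Definition CS (m : nat) (E F : normedModType R) (S : set E) (lam0 : R)
    (f : E -> R -> F) :=
  Cm_on m (S `*` eps_dom lam0) (fun p => f p.1 (p.2 ^+ 2)).

Definition CS1 (m : nat) (F : normedModType R) (lam0 : R) (f : R -> F) :=
  Cm_on m (eps_dom lam0) (fun eps => f (eps ^+ 2)).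

Definition half_open (tau : \bar R) : set R := [set t : R | 0 <= t /\ (t%:E < tau)%E].

Definition ode_solution (V : normedModType R) (tau : \bar R) (y : R -> V)
    (f : R -> V -> V) :=
  {within half_open tau, continuous y} /\
  forall t : R, 0 < t -> (t%:E < tau)%E -> is_derive t 1 y (f t (y t)).

Definition orbitally_stable (V : normedModType R) (f : V -> V) (q : R -> V) :=
  forall eta : R, 0 < eta -> exists2 delta : R, 0 < delta &
    forall tau (p : R -> V), ode_solution tau p (fun=> f) ->
      `|p 0 - q 0| < delta ->
      forall t, half_open tau t -> exists2 s : R, 0 <= s & `|p t - q s| < eta.

End Smoothness.

Section Rotations.
Context {R : realType}.
Implicit Types (A X Y : 'M[R]_3) (v : 'cV[R]_3).

Definition SO3 : set 'M[R]_3 := [set A | A^T *m A = 1%:M /\ \det A = 1].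

Definition so3 : set 'M[R]_3 := [set Y | Y^T = - Y].

Definition expm Y : 'M[R]_3 :=
  limn (series (fun n : nat => (n`!%:R)^-1 *: Y ^+ n)).

(* The matrix norm of the library is the sup norm; this is the Euclidean one. *)
Definition enorm n (v : 'cV[R]_n) : R := Num.sqrt (\sum_i v i 0 ^+ 2).

(* The vector w0 such that Y w = w0 x w (cross product) for all w, that is
   Y = [[0, -c, b], [c, 0, -a], [-b, a, 0]] and w0 = (a, b, c). *)
Definition vec Y : 'cV[R]_3 := \col_i [:: Y 2 1; Y 0 2; Y 1 0]`_i.

Definition norm_so3 Y : R := enorm (vec Y).

End Rotations.

Section QD.
Context {R : realType}.
Implicit Types (Y : 'M[R]_3) (v w : 'cV[R]_3).

Definition north : set 'cV[R]_3 := [set v | enorm v = 1 /\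
  (0 < v 2 0 \/ [/\ v 2 0 = 0, -1 <= v 0 0 < 1 & 0 <= v 1 0 <= 1])].

Definition same_hemisphere v w := north v <-> north w.

Definition unit_vec Y : 'cV[R]_3 := (norm_so3 Y)^-1 *: vec Y.

(* For 0 < |Y| < 2 pi, the other vector of norm < 2 pi with the same
   exponential. *)
Definition wrap Y : 'M[R]_3 := (1 - 2 * pi / norm_so3 Y) *: Y.

(* The classes [Y] of D are represented by their elements, |Y| <= pi.  Exactly
   one of v, -v is in the north hemisphere, so that q takes the same value at Y
   and -Y if |Y| = pi, and q(D) consists of matrices of norm < 2 pi, among which
   O_3 represents all the matrices of norm 2 pi. *)
Definition qmap (X0 : 'M[R]_3) Y : 'M[R]_3 :=
  if `[< Y = 0 \/ same_hemisphere (unit_vec Y) (unit_vec X0) >] then Y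
  else wrap Y.

Definition qD (X0 : 'M[R]_3) : set 'M[R]_3 := qmap X0 @` [set Y | so3 Y /\ norm_so3 Y <= pi].

(* Class C^m for q(D)-valued maps.  D is the quotient of the open ball
   {|Y| < 2 pi} of so(3) by Y ~ wrap Y (Y != 0), which extends the identification
   of Y with -Y on |Y| = pi, and the quotient map is a local diffeomorphism onto
   D.  Hence a map into D, or into q(D) with the structure transported by q, is
   C^m iff it has local C^m lifts to this ball.  Continuity across O_3 ~ {|Y| =
   2 pi} is allowed: there the lift is near O_3. *)
Definition Cm_on_qD (m : nat) (E : normedModType R) (X0 : 'M[R]_3) (S : set E)
    (f : E -> 'M[R]_3) :=
  (forall x, S x -> qD X0 (f x)) /\
  forall x, S x -> exists (U : set E) (g : E -> 'M[R]_3),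
    [/\ open U, U x, Cm m U g &
        forall y, U y -> S y -> [/\ so3 (g y), norm_so3 (g y) < 2 * pi &
          f y = g y \/ (g y != 0 /\ f y = wrap (g y))]].

Definition CS_qD (m : nat) (E : normedModType R) (X0 : 'M[R]_3) (S : set E) (lam0 : R)
    (f : E -> R -> 'M[R]_3) :=
  Cm_on_qD m X0 (S `*` eps_dom lam0) (fun p => f p.1 (p.2 ^+ 2)).

Definition CS1_qD (m : nat) (X0 : 'M[R]_3) (lam0 : R) (f : R -> 'M[R]_3) :=
  Cm_on_qD m X0 (eps_dom lam0) (fun eps => f (eps ^+ 2)).

End QD.

Section Sphere.
Context {R : realType} (r : R).
Implicit Types (phi f : 'cV[R]_3 -> R).

Definition sph (p : R * R) : 'cV[R]_3 :=
  \col_i [:: r * sin p.1 * cos p.2; r * sin p.1 * sin p.2; r * cos p.1]`_i.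

Definition leb2 := ((@lebesgue_measure R) \x (@lebesgue_measure R))%E.

Definition angles : set (measurableTypeR R * measurableTypeR R) :=
  `]0, pi[%classic `*` `]0, 2 * pi[%classic.

(* The surface measure of the sphere, in spherical coordinates; they miss only a
   null set. *)
Definition sph_int f : R :=
  Rintegral leb2 angles (fun p => f (sph p) * (r ^+ 2 * sin p.1)).

Definition sph_ae (P : 'cV[R]_3 -> Prop) : Prop :=
  {ae leb2, forall p, angles p -> P (sph p)}.

Definition sph_L2 f : Prop :=
  measurable_fun angles (fun p => f (sph p)) /\
  (\int[leb2]_(p in angles) (f (sph p) ^+ 2 * (r ^+ 2 * sin p.1))%:E < +oo)%E.

(* The extension of phi from the sphere, homogeneous of degree 0. *)
Definition hext phi : 'cV[R]_3 -> R := fun x => phi ((r / enorm x) *: x).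

Definition sph_smooth phi : Prop :=
  forall m, Cm m [set x : 'cV[R]_3 | x != 0] (hext phi).

(* On the sphere the Laplace-Beltrami operator is the Laplacian of R^3 applied to
   the extension that is homogeneous of degree 0. *)
Definition lapS phi : 'cV[R]_3 -> R := fun x =>
  \sum_(i < 3) 'D_(delta_mx i 0) ('D_(delta_mx i 0) (hext phi)) x.

(* d/dt phi(e^{-tX} x) at t = 0. *)
Definition rot_gen (X : 'M[R]_3) phi : 'cV[R]_3 -> R := fun x =>
  'D_(- (X *m x)) (hext phi) x.

(* A Hilbert basis of L^2(rS^2) of smooth eigenfunctions of - lapS. *)
Record eigenbasis (e : nat -> 'cV[R]_3 -> R) (ev : nat -> R) : Prop := {
  eb_smooth : forall k, sph_smooth (e k);
  eb_eigen : forall k x, enorm x = r -> lapS (e k) x = - ev k * e k x;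
  eb_orthonormal : forall j k, sph_int (fun x => e j x * e k x) = (j == k)%:R;
  eb_complete : forall f, sph_L2 f ->
    (forall k, sph_int (fun x => f x * e k x) = 0) -> sph_ae (fun x => f x = 0)
}.

End Sphere.

Section Spaces.
Context {R : realType} {N : nat} (r : R).
Context (e : nat -> 'cV[R]_3 -> R) (ev : nat -> R) (d : 'I_N -> R).
Implicit Types (f : 'cV[R]_3 -> 'cV[R]_N) (w : 'I_N -> nat -> R).

Definition coef f (i : 'I_N) (k : nat) : R :=
  sph_int r (fun x => f x i 0 * e k x).

Definition wnorm2 w f : \bar R :=
  (\sum_(i < N) \sum_(0 <= k <oo) (w i k * coef f i k ^+ 2)%:E)%E.

(* [fspace w rep]: through the choice of representatives [rep], the normed space
   E is the space of the classes (for equality a.e.) of the square integrable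
   f : rS^2 -> R^N with sum_i sum_k w i k <f_i, e_k>^2 < oo, with its Hilbert
   norm. *)
Record fspace w (E : normedModType R) (rep : E -> 'cV[R]_3 -> 'cV[R]_N) : Prop := {
  fs_L2 : forall u i, sph_L2 r (fun x => rep u x i 0);
  fs_norm : forall u, ((`|u| ^+ 2)%:E = wnorm2 w (rep u))%E;
  fs_linear : forall (a : R) u v,
    sph_ae r (fun x => rep (a *: u + v) x = a *: rep u x + rep v x);
  fs_full : forall f, (forall i, sph_L2 r (fun x => f x i 0)) ->
    (wnorm2 w f < +oo)%E -> exists u, sph_ae r (fun x => rep u x = f x)
}.

(* L^2 if all the d_i are positive, H^2 otherwise. *)
Definition weightY (i : 'I_N) (k : nat) : R :=
  if [forall j, 0 < d j] then 1 else (1 + ev k) ^+ 2.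

(* The domain of (I - D_diff Delta_S)^al in Y: this operator multiplies the
   coefficient of e_k in the i-th component by (1 + d_i ev_k)^al. *)
Definition weightYa (al : R) (i : 'I_N) (k : nat) : R :=
  weightY i k * ((1 + d i * ev k) `^ (2 * al)).

Definition wdot w f g : R :=
  \sum_(i < N) limn (series (fun k => w i k * coef f i k * coef g i k)).

End Spaces.

Section Operators.
Context {R : realType} {Y : normedModType R}.
Implicit Types (L : Y -> Y -> Prop) (W : set Y) (P : Y -> Y).

(* [L] is the graph of a closed real operator, [W] a closed invariant subspace.
   The number z = z.1 + i z.2 is in the spectrum of the complexification of
   L restricted to W iff z - L is not bijective onto the complexification of W
   (the inverse is then bounded, by the closed graph theorem). *)
Definition spectrum L W : set (R * R) := [set z |
  ~ forall f g, W f -> W g -> exists! p : Y * Y,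
      [/\ W p.1, W p.2 &
      exists w1 w2, [/\ L p.1 w1, L p.2 w2,
        z.1 *: p.1 - z.2 *: p.2 - w1 = f &
        z.2 *: p.1 + z.1 *: p.2 - w2 = g]]].

Definition spectral_set L (s : set (R * R)) : Prop :=
  [/\ s `<=` spectrum L setT, bounded_set s, closed s &
      closed (spectrum L setT `\` s)].

Definition range_proj P : set Y := [set y | P y = y].
Definition ker_proj P : set Y := [set y | P y = 0].

Record spectral_projection L (s : set (R * R)) P : Prop := {
  sp_linear : forall (a : R) u v, P (a *: u + v) = a *: P u + P v;
  sp_continuous : continuous P;
  sp_idem : forall u, P (P u) = P u;
  sp_reduces : forall u w, L u w -> L (P u) (P w);
  sp_bounded : forall u, exists w, L (P u) w;
  sp_range : spectrum L (range_proj P) = s;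
  sp_ker : spectrum L (ker_proj P) = spectrum L setT `\` s
}.

Record c0_semigroup L (S : R -> Y -> Y) : Prop := {
  c0_linear : forall (t a : R) u v, 0 <= t ->
    S t (a *: u + v) = a *: S t u + S t v;
  c0_bounded : forall t : R, 0 <= t -> continuous (S t);
  c0_zero : forall u, S 0 u = u;
  c0_add : forall (t s : R) u, 0 <= t -> 0 <= s -> S (t + s) u = S t (S s u);
  c0_strong : forall u, S t u @[t --> 0^'+] --> u;
  c0_generator : forall u w,
    L u w <-> t^-1 *: (S t u - u) @[t --> 0^'+] --> w
}.

Definition is_basis n (b : 'I_n -> Y) (W : set Y) : Prop :=
  (forall y, W y <-> exists c : 'I_n -> R, y = \sum_i c i *: b i) /\
  (forall c : 'I_n -> R, \sum_i c i *: b i = 0 -> forall i, c i = 0).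

End Operators.

Section Equation.
Context {R : realType} {N : nat} (r : R) (d : 'I_N -> R).
Context (F : 'cV[R]_N -> R -> 'cV[R]_N).
Context {Y Ya : normedModType R}.
Context (repY : Y -> 'cV[R]_3 -> 'cV[R]_N) (repYa : Ya -> 'cV[R]_3 -> 'cV[R]_N).
Context (act : 'M[R]_3 -> Ya -> Ya).
Context (dom : R -> Ya -> R -> Prop) (Phi : R -> Ya -> R -> Ya).

(* u_t = D_diff Delta_S u + F(u, lam) on [0, tau), tested against smooth
   functions, for a curve that is continuous in Y^alpha. *)
Definition rd_solution (lam : R) (tau : \bar R) (v : R -> Ya) : Prop :=
  {within half_open tau, continuous v} /\
  forall i phi, sph_smooth r phi -> forall t : R, 0 < t -> (t%:E < tau)%E ->
    is_derive t 1 (fun s => sph_int r (fun x => repYa (v s) x i 0 * phi x))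
      (d i * sph_int r (fun x => repYa (v t) x i 0 * lapS r phi x)
       + sph_int r (fun x => F (repYa (v t) x) lam i 0 * phi x)).

Definition rotation_action : Prop :=
  [/\ forall u, act 1%:M u = u,
      forall A B, SO3 A -> SO3 B -> forall u, act (A *m B) u = act A (act B u) &
      forall A, SO3 A -> forall u,
        sph_ae r (fun x => repYa (act A u) x = repYa u (A^-1 *m x))].

(* [Phi t u lam] is only meaningful if [dom t u lam]. *)
Record rd_semiflow (M : nat) : Prop := {
  sf_zero : forall u lam, dom 0 u lam /\ Phi 0 u lam = u;
  sf_nonneg : forall t u lam, dom t u lam -> 0 <= t;
  sf_down : forall (s t : R) u lam, dom t u lam -> 0 <= s <= t -> dom s u lam;
  sf_add : forall (s t : R) u lam, 0 <= t -> dom s u lam ->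
    (dom (t + s) u lam <-> dom t (Phi s u lam) lam) /\
    (dom (t + s) u lam -> Phi (t + s) u lam = Phi t (Phi s u lam) lam);
  sf_open : exists2 O : set (R * (Ya * R)), open O &
    forall t u lam, dom t u lam <-> 0 <= t /\ O (t, (u, lam));
  sf_continuous :
    {within [set p : R * (Ya * R) | dom p.1 p.2.1 p.2.2],
      continuous (fun p : R * (Ya * R) => Phi p.1 p.2.1 p.2.2)};
  sf_smooth : forall t : R, 0 <= t ->
    Cm M [set p : Ya * R | dom t p.1 p.2] (fun p => Phi t p.1 p.2);
  sf_solution : forall u lam tau, (0%:E < tau)%E ->
    (forall t, half_open tau t -> dom t u lam) ->
    rd_solution lam tau (fun t => Phi t u lam);
  sf_unique : forall v lam tau, (0%:E < tau)%E -> rd_solution lam tau v ->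
    forall t, half_open tau t -> dom t (v 0) lam /\ Phi t (v 0) lam = v t
}.

Definition equivariant : Prop :=
  forall A, SO3 A -> forall t u lam,
    (dom t (act A u) lam <-> dom t u lam) /\
    (dom t u lam -> Phi t (act A u) lam = act A (Phi t u lam)).

Definition trivial_isotropy (u : Ya) : Prop :=
  forall A, SO3 A -> act A u = u -> A = 1%:M.

Definition relative_equilibrium (u : Ya) (X : 'M[R]_3) (lam : R) : Prop :=
  so3 X /\
  forall t : R, 0 <= t -> dom t u lam /\ Phi t u lam = act (expm (t *: X)) u.

Definition equilibrium (u : Ya) (lam : R) : Prop :=
  forall t : R, 0 <= t -> dom t u lam /\ Phi t u lam = u.

(* The linearisation L = D_diff Delta_S + D_u F(u0, 0) - X0 as a closed operator
   in Y, by its graph; the derivatives are moved to the test functions, the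
   infinitesimal generator X0 being antisymmetric. *)
Definition linearisation (u0 : Ya) (X0 : 'M[R]_3) (y w : Y) : Prop :=
  forall i phi, sph_smooth r phi ->
    sph_int r (fun x => repY w x i 0 * phi x) =
      d i * sph_int r (fun x => repY y x i 0 * lapS r phi x)
      + sph_int r (fun x =>
          ('d (F^~ 0) (repYa u0 x) (repY y x) : 'cV[R]_N) i 0 * phi x)
      + sph_int r (fun x => repY y x i 0 * rot_gen r X0 phi x).

(* T is the least positive time at which the solution from u is back in the group
   orbit of u. *)
Definition relative_period (u : Ya) (lam T : R) : Prop :=
  let back t := dom t u lam /\ exists2 A, SO3 A & Phi t u lam = act A u in
  [/\ 0 < T, back T & forall t : R, 0 < t < T -> ~ back t].

Definition primary_frequency (u : Ya) (lam : R) (X : 'M[R]_3) : Prop :=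
  so3 X /\ exists2 T : R, relative_period u lam T &
    Phi T u lam = act (expm (T *: X)) u.

End Equation.

Section CenterManifold.
Context {R : realType} {Y Ya : normedModType R}.
Context (act : 'M[R]_3 -> Ya -> Ya) (inc : Ya -> Y).
Context (dom : R -> Ya -> R -> Prop) (Phi : R -> Ya -> R -> Ya).

(* The tangent space at u to its group orbit. *)
Definition orbit_tangent (u : Ya) : set Y := [set y |
  exists2 X, so3 X & is_derive (0 : R) 1 (fun t => inc (act (expm (t *: X)) u)) y].

(* Psi is a chart of M^cu for q in V_*, of dimension 2 = 5 - 3; V_* is identified with the space of row vectors by
   means of a basis, so that Psi, X_G and X_N are functions of the coordinates of
   q in V_*.  The manifold depends on lam, hence so does its chart. *)
Record center_manifold (M : nat) (u0 : Ya) (X0 : 'M[R]_3) (P : Y -> Y)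
    (Mcu : R -> set Ya) (Psi : 'rV[R]_2 -> R -> Ya)
    (XG : 'rV[R]_2 -> R -> 'M[R]_3) (XN : 'rV[R]_2 -> R -> 'rV[R]_2) : Prop := {
  cm_base : Psi 0 0 = u0;
  cm_tangent : forall y, range_proj P y <-> exists X q, so3 X /\
    is_derive (0 : R) 1 (fun t => inc (act (expm (t *: X)) (Psi (t *: q) 0))) y;
  cm_so3 : forall q lam, so3 (XG q lam);
  cm_XG_smooth : Cm M setT (fun p : 'rV[R]_2 * R => XG p.1 p.2);
  cm_XN_smooth : Cm M setT (fun p : 'rV[R]_2 * R => XN p.1 p.2);
  cm_XG0 : XG 0 0 = X0;
  cm_XN0 : XN 0 0 = 0;
  cm_reduction : exists2 delta : R, 0 < delta & forall lam : R, `|lam| < delta ->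
    [/\ diffeo_on M [set p : 'M[R]_3 * 'rV[R]_2 | SO3 p.1] (Mcu lam)
          (fun p => act p.1 (Psi p.2 lam)),
        forall tau (A : R -> 'M[R]_3) (q : R -> 'rV[R]_2), (0%:E < tau)%E ->
          ode_solution tau A (fun t B => B *m XG (q t) lam) ->
          ode_solution tau q (fun _ p => XN p lam) ->
          (forall t, half_open tau t -> SO3 (A t) /\ `|q t| < delta) ->
          forall t, half_open tau t ->
            dom t (act (A 0) (Psi (q 0) lam)) lam /\
            Phi t (act (A 0) (Psi (q 0) lam)) lam = act (A t) (Psi (q t) lam) &
        forall tau u, (0%:E < tau)%E ->
          (forall t, half_open tau t -> dom t u lam /\ exists B p,
            [/\ SO3 B, `|p| < delta & Phi t u lam = act B (Psi p lam)]) ->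
          exists (A : R -> 'M[R]_3) (q : R -> 'rV[R]_2),
            [/\ ode_solution tau A (fun t B => B *m XG (q t) lam),
                ode_solution tau q (fun _ p => XN p lam) &
                forall t, half_open tau t -> [/\ SO3 (A t), `|q t| < delta &
                  Phi t u lam = act (A t) (Psi (q t) lam)]]]
}.

End CenterManifold.

Section Hopf.
Context {R : realType}.

Definition period_of (om : R -> R) (lam : R) : R := 2 * pi / `|om lam|.

Record hopf_bifurcation (M : nat) (XN : 'rV[R]_2 -> R -> 'rV[R]_2)
    (al be : R -> R) (ombif lam0 : R) (q rr : R -> R -> 'rV[R]_2)
    (om : R -> R) : Prop := {
  hb_trivial : exists2 delta : R, 0 < delta &
    forall lam : R, `|lam| < delta -> XN 0 lam = 0;
  hb_eigen : exists2 delta : R, 0 < delta & forall lam : R, `|lam| < delta ->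
    let J := map_mx (real_complex R) ('J (XN^~ lam) 0) in
    eigenvalue J (Complex (al lam) (ombif + be lam)) /\
    eigenvalue J (Complex (al lam) (- (ombif + be lam)));
  hb_al0 : al 0 = 0;
  hb_be0 : be 0 = 0;
  hb_cross : exists2 a' : R, 0 < a' & is_derive (0 : R) 1 al a';
  hb_ombif : ombif != 0;
  hb_lam0 : 0 < lam0;
  hb_q : forall t lam : R, 0 <= t -> 0 <= lam < lam0 ->
    q t lam = Num.sqrt lam *: rr t lam;
  hb_q_O : exists C : R, forall t lam : R, 0 <= t -> 0 <= lam < lam0 ->
    `|q t lam| <= C * Num.sqrt lam;
  hb_q_CS : CS M [set t : R | 0 <= t] lam0 q;
  hb_rr_CS : CS M [set t : R | 0 <= t] lam0 rr;
  hb_om_CS : CS1 M lam0 om;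
  hb_om_O : exists C : R, forall lam : R, 0 <= lam < lam0 -> `|om lam - ombif| <= C * lam;
  hb_om_neq0 : forall lam : R, 0 <= lam < lam0 -> om lam != 0;
  hb_solution : forall lam : R, 0 < lam < lam0 ->
    ode_solution +oo%E (q^~ lam) (fun _ p => XN p lam);
  hb_period : forall lam : R, 0 < lam < lam0 -> forall t : R, 0 <= t ->
    q (t + period_of om lam) lam = q t lam;
  hb_minimal : forall lam : R, 0 < lam < lam0 -> forall s : R, 0 < s < period_of om lam ->
    exists2 t : R, 0 <= t & q (t + s) lam <> q t lam;
  hb_stable : forall lam : R, 0 < lam < lam0 ->
    orbitally_stable (XN^~ lam) (q^~ lam)
}.

Definition XGt (XG : 'rV[R]_2 -> R -> 'M[R]_3) (X0 : 'M[R]_3)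
    (q : R -> R -> 'rV[R]_2) (t lam : R) : 'M[R]_3 :=
  if 0 < lam then XG (q t lam) lam else X0.

End Hopf.

Section Branch.
Context {R : realType} {Ya : normedModType R}.
Context (act : 'M[R]_3 -> Ya -> Ya).
Context (dom : R -> Ya -> R -> Prop) (Phi : R -> Ya -> R -> Ya).

(* [u lam] is the initial value u_lam of the branch of solutions and [lam1] the
   bound expressing "lam small". *)
Record frequency_branch (m : nat) (u0 : Ya) (X0 : 'M[R]_3) (u : R -> Ya)
    (om : R -> R) (ombif lam1 : R) (X : R -> 'M[R]_3) : Prop := {
  fb_CS : CS1_qD m X0 lam1 (fun lam => period_of om lam *: X lam);
  fb_qD : forall lam : R, 0 <= lam < lam1 -> qD X0 (period_of om lam *: X lam);
  fb_primary : forall lam : R, 0 < lam < lam1 ->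
    primary_frequency act dom Phi (u lam) lam (X lam);
  fb_zero : Phi (2 * pi / `|ombif|) u0 0 =
    act (expm ((2 * pi / `|ombif|) *: X 0)) u0
}.

End Branch.

(* Main.v *)
Require Import Defs.
From HB Require Import structures.
From mathcomp Require Import all_boot all_order all_algebra.
From mathcomp Require Import all_classical all_reals all_analysis.
From mathcomp Require Import ring lra.

Import Order.TTheory GRing.Theory Num.Theory.
Import numFieldNormedType.Exports.

Local Open Scope classical_set_scope.
Local Open Scope ring_scope.

(** On the center manifold the branch is Phi(t, u_lam, lam) = A(t, lam) Psi(q(t, lam)),
with u_lam = Psi(q(0, lam)), because A(0, lam) = 1 and the sup norm of q is
O(sqrt lam), hence inside the domain of the reduction for small lam.

The least period T of q(., lam) is the relative period of u_lam: the solution is in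
the group orbit of u_lam at time T since q(T) = q(0); if it were there at an earlier
time s, with Phi(s, u_lam) = B u_lam, then equivariance and the semigroup law would
give A(t + s) Psi(q(t + s)) = B A(t) Psi(q(t)) for all t, and the injectivity of
(A, p) |-> A Psi(p) would make s a period of q ([relative_period_branch]).  At time T
one reads Phi(T, u_lam) = A(T) u_lam = e^{Z(T)} u_lam, so X = Z(T) / T is a primary
frequency vector.  At lam = 0 the same reduction applied to the curve q = 0 gives the
relation for u_0.

The branch is CS because T X = Z(T, .) is a composition of C^m maps: the chain rule
for [Cm] is [Cm_comp], and T = 2 pi / |omega| is smooth since omega does not vanish,
hence has locally constant sign ([CS1_qD_period]).

For uniqueness, a second branch X' has the same relative period, so e^{T X'} and
e^{T X} move Psi(q(0, lam)) to the same point; both are rotations, hence equal.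
Finally Y |-> e^Y is injective on q(D) ([expm_qD_inj]): a nonzero element of q(D) has
norm theta in (0, 2 pi) and its axis n lies in the hemisphere of that of X_0
([qD_spec]).  By Rodrigues' formula ([expmE]) the rotation e^Y determines cos theta by its
trace, n up to sign by its symmetric part, then n itself by the hemisphere, and
sin theta by its antisymmetric part. *)

Set Implicit Arguments.
Unset Strict Implicit.
Unset Printing Implicit Defensive.

(** * Calculus of maps of class C^m *)

(** The class [Cm] is stated with total differentials of globally defined maps, so that
its locality rests on the differential depending only on the germ. *)
Lemma near_eq_differentiable (R : realType) (E F : normedModType R) (f g : E -> F) x :
  (\forall y \near x, f y = g y) -> differentiable f x ->
  differentiable g x /\ ('d g x = 'd f x :> (E -> F)).
Proof.
move=> fg df.
have /diff_locallyP[cdf /eqaddoP ef] := df.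
have eg : g \o shift x = cst (g x) + 'd f x +o_ 0 id.
  have fg0 : \forall h \near 0, f (h + x) = g (h + x).
    by rewrite (near_shift 0 x) subr0 in fg; exact: fg.
  apply/eqaddoP => e e0; apply: filterS2 fg0 (ef e e0) => h /= fgh fh.
  rewrite -[X in `|X|]/(g (h + x) - (g x + 'd f x h)) -fgh -(nbhs_singleton fg).
  exact: fh.
have dg : 'd g x = 'd f x :> (E -> F) by apply: diff_unique.
split; last exact: dg.
apply/diff_locallyP; split; first by rewrite dg; exact: cdf.
by rewrite dg; exact: eg.
Qed.

Lemma openXT (R : realType) (E F : normedModType R) (U : set E) :
  open U -> open (U `*` [set: F]).
Proof.
move=> oU; rewrite openE => -[x y] [Ux _].
exists (U, setT) => /=; last by move=> p [].
by split; [exact: open_nbhs_nbhs|exact: filterT].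
Qed.

(** Every tangent map is computed only at points of U, by a formula valid on U; this
lemma is what lets such a formula replace the differential. *)
Lemma Cm_ext (R : realType) m (E F : normedModType R) (U : set E) (f g : E -> F) :
  open U -> (forall x, U x -> f x = g x) -> Cm m U f -> Cm m U g.
Proof.
elim: m E F U f g => [|m IH] E F U f g oU fg /=.
  move=> cf x Ux.
  have nfg : \forall y \near x, f y = g y.
    by apply: filterS (open_nbhs_nbhs (conj oU Ux)) => y /fg.
  have cfx : f @ x --> g x by rewrite -(fg x Ux); exact: cf.
  by apply: cvg_trans cfx; exact: near_eq_cvg.
have nfg x : U x -> \forall y \near x, f y = g y.
  by move=> Ux; apply: filterS (open_nbhs_nbhs (conj oU Ux)) => y /fg.
move=> [df cf]; split.
  by move=> x Ux; have [] := near_eq_differentiable (nfg x Ux) (df x Ux).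
apply: IH cf; first exact: openXT.
move=> p [Up _].
have [_ dgf] := near_eq_differentiable (nfg _ Up) (df _ Up).
exact: (esym (congr1 (@^~ p.2) dgf)).
Qed.

Lemma Cm_subset (R : realType) m (E F : normedModType R) (U V : set E) (f : E -> F) :
  V `<=` U -> Cm m U f -> Cm m V f.
Proof.
elim: m E F U V f => [|m IH] E F U V f VU /=; first by move=> cf x /VU/cf.
move=> [df cf]; split; first by move=> x /VU/df.
by apply: IH cf => p [/VU].
Qed.

Lemma Cm_pred (R : realType) m (E F : normedModType R) (U : set E) (f : E -> F) :
  Cm m.+1 U f -> Cm m U f.
Proof.
elim: m E F U f => [|m IH] E F U f [df cf].
  by move=> x Ux; apply: differentiable_continuous; exact: df.
by split => //; exact: IH.
Qed.

Lemma Cm_continuous (R : realType) m (E F : normedModType R) (U : set E) (f : E -> F) :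
  Cm m U f -> forall x, U x -> {for x, continuous f}.
Proof. by elim: m => [//|m IH] /Cm_pred. Qed.

(** The tangent map of a continuous linear f is f o snd, again continuous and linear. *)
Lemma Cm_linear (R : realType) m (E F : normedModType R) (U : set E)
  (f : {linear E -> F}) : continuous f -> Cm m U f.
Proof.
elim: m E F U f => [|m IH] E F U f cf; first by move=> x _; exact: cf.
split; first by move=> x _; exact: linear_differentiable.
have -> : (fun p : E * E => 'd f (p.1) p.2) = f \o snd.
  by apply/funext => p /=; rewrite (diff_lin _ cf).
apply: (IH _ _ _ (f \o snd : {linear (E * E)%type -> F})).
by move=> x; apply: continuous_comp; [exact: cvg_snd|exact: cf].
Qed.

Lemma Cm_fst (R : realType) m (E F : normedModType R) (U : set (E * F)) :
  Cm m U (fst : E * F -> E).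
Proof.
by apply: (@Cm_linear _ _ _ _ _ (fst : {linear (E * F)%type -> E})) => x; exact: cvg_fst.
Qed.

Lemma Cm_id (R : realType) m (E : normedModType R) (U : set E) : Cm m U (id : E -> E).
Proof. by apply: (@Cm_linear _ _ _ _ _ (idfun : {linear E -> E})) => x; exact: cvg_id. Qed.

Lemma Cm_cst (R : realType) m (E F : normedModType R) (U : set E) (c : F) :
  Cm m U (cst c : E -> F).
Proof.
elim: m E F U c => [|m IH] E F U c; first by move=> x _; exact: cst_continuous.
split; first by move=> x _; exact: differentiable_cst.
have -> : (fun p : E * E => 'd (cst c : E -> F) (p.1) p.2) = cst 0.
  by apply/funext => p /=; rewrite diff_cst.
exact: IH.
Qed.

Lemma Cm_pair (R : realType) m (E F G : normedModType R) (U : set E)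
    (f : E -> F) (g : E -> G) :
  open U -> Cm m U f -> Cm m U g -> Cm m U (fun x => (f x, g x)).
Proof.
elim: m E F G U f g => [|m IH] E F G U f g oU.
  by move=> cf cg x Ux; apply: cvg_pair => /=; [exact: cf|exact: cg].
move=> [df cf] [dg cg]; split.
  by move=> x Ux; apply: differentiable_pair; [exact: df|exact: dg].
apply: (Cm_ext (f := fun p => ('d f (p.1) p.2, 'd g (p.1) p.2))).
- exact: openXT.
- by move=> p [Up _]; rewrite diff_pair //; [exact: df|exact: dg].
- by apply: IH => //; exact: openXT.
Qed.

(** Chain rule for tangent maps: T(g o f) = Tg o Tf, where Tg is taken as
(y, w) |-> Dg(y) w and Tf as (x, v) |-> (f x, Df(x) v), both of class C^m. *)
Lemma Cm_comp (R : realType) m (E F G : normedModType R) (U : set E) (V : set F)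
    (f : E -> F) (g : F -> G) :
  open U -> (forall x, U x -> V (f x)) -> Cm m U f -> Cm m V g -> Cm m U (g \o f).
Proof.
elim: m E F G U V f g => [|m IH] E F G U V f g oU fUV.
  by move=> cf cg x Ux; apply: continuous_comp; [exact: cf|exact/cg/fUV].
move=> Cf [dg cg]; have [df cf] := Cf; split.
  by move=> x Ux; apply: differentiable_comp; [exact: df|exact/dg/fUV].
have oUT := openXT (F := E) oU.
apply: (Cm_ext (f := (fun p => 'd g (p.1) p.2) \o (fun p => (f p.1, 'd f (p.1) p.2)))).
- exact: oUT.
- by move=> p [Up _]; rewrite diff_comp //; [exact: df|exact/dg/fUV].
- apply: (IH _ _ _ _ (V `*` setT)) cg; first exact: oUT.
    by move=> p [Up _]; split => //=; exact: fUV.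
  apply: Cm_pair => //.
  apply: (IH _ _ _ _ U fst f) => //; first by move=> p [].
  + exact: Cm_fst.
  + exact: Cm_pred.
Qed.

Lemma CmD (R : realType) m (E : normedModType R) (U : set E) (f g : E -> R) :
  open U -> Cm m U f -> Cm m U g -> Cm m U (fun x => f x + g x).
Proof.
elim: m E U f g => [|m IH] E U f g oU.
  by move=> cf cg x Ux; apply: cvgD; [exact: cf|exact: cg].
move=> [df cf] [dg cg]; split.
  by move=> x Ux; apply: differentiableD; [exact: df|exact: dg].
apply: (Cm_ext (f := fun p => 'd f (p.1) p.2 + 'd g (p.1) p.2)).
- exact: openXT.
- by move=> p [Up _]; rewrite diffD //; [exact: df|exact: dg].
- by apply: IH => //; exact: openXT.
Qed.

Lemma CmM (R : realType) m (E : normedModType R) (U : set E) (f g : E -> R) :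
  open U -> Cm m U f -> Cm m U g -> Cm m U (fun x => f x * g x).
Proof.
elim: m E U f g => [|m IH] E U f g oU.
  by move=> cf cg x Ux; apply: cvgM; [exact: cf|exact: cg].
move=> Cf Cg; have [df cf] := Cf; have [dg cg] := Cg; split.
  by move=> x Ux; apply: differentiableM; [exact: df|exact: dg].
have oUT := openXT (F := E) oU.
have lift (h : E -> R) : Cm m.+1 U h -> Cm m (U `*` [set: E]) (h \o fst).
  move=> Ch; apply: (Cm_comp (V := U)) => //; first by move=> p [].
  + exact: Cm_fst.
  + exact: Cm_pred.
apply: (@Cm_ext _ _ _ _ _
    (fun p => f p.1 * 'd g (p.1) p.2 + g p.1 * 'd f (p.1) p.2)) => //.
- by move=> p [Up _]; rewrite diffM //; [exact: df|exact: dg].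
- by apply: CmD => //; apply: IH => //; exact: lift.
Qed.

(** The differential of 1/f is - Df / f^2, a product of maps of class C^m by
induction. *)
Lemma Cm_inv (R : realType) m (E : normedModType R) (U : set E) (f : E -> R) :
  open U -> (forall x, U x -> f x != 0) -> Cm m U f -> Cm m U (fun x => (f x)^-1).
Proof.
elim: m E U f => [|m IH] E U f oU f0.
  by move=> cf x Ux; apply: cvgV; [exact: f0|exact: cf].
move=> Cf; have [df cf] := Cf; split.
  by move=> x Ux; apply: differentiableV; [exact: df|exact: f0].
have oUT := openXT (F := E) oU.
have Cfi : Cm m (U `*` [set: E]) (fun p => (f p.1)^-1).
  apply: (Cm_comp (V := U) (f := fst) (g := fun x => (f x)^-1)) => //.
  + by move=> p [].
  + exact: Cm_fst.
  + by apply: IH => //; exact: Cm_pred.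
apply: (@Cm_ext _ _ _ _ _
    (fun p => (-1) * ((f p.1)^-1 * ((f p.1)^-1 * 'd f (p.1) p.2)))) => //.
- move=> p [Up _]; rewrite diffV //; [|exact: df|exact: f0].
  rewrite -[RHS]/(- f p.1 ^- 2 * 'd f (p.1) p.2).
  by rewrite mulN1r -exprVn expr2 mulNr mulrA.
- apply: CmM => //; first exact: Cm_cst.
  by do 2![apply: CmM => //].
Qed.

(** * Rotations and their exponential coordinates *)

Section Rotations.
Context {R : realType}.
Implicit Types (X Y W : 'M[R]_3) (v w : 'cV[R]_3).

Lemma ord3P (i : 'I_3) : [\/ i = 0, i = 1 | i = 2].
Proof.
by case: i => [[|[|[|//]]] ?]; [apply: Or31|apply: Or32|apply: Or33]; exact: val_inj.
Qed.

Lemma sum3E (V : zmodType) (f : 'I_3 -> V) : \sum_i f i = f 0 + f 1 + f 2.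
Proof.
rewrite !big_ord_recl big_ord0 addr0 addrA.
by congr (_ + _ + _); congr f; exact: val_inj.
Qed.

Lemma so3_entries Y : so3 Y ->
  [/\ Y 0 0 = 0, Y 1 1 = 0 & Y 2 2 = 0] /\
  [/\ Y 0 1 = - Y 1 0, Y 2 0 = - Y 0 2 & Y 1 2 = - Y 2 1].
Proof.
move=> YT; have Yij i j : Y j i = - Y i j.
  by have /matrixP/(_ i j) := YT; rewrite !mxE.
have diag i : Y i i = 0 by have := Yij i i; lra.
by [].
Qed.

Lemma vecE Y : [/\ vec Y 0 0 = Y 2 1, vec Y 1 0 = Y 0 2 & vec Y 2 0 = Y 1 0].
Proof. by rewrite /vec !mxE. Qed.

Lemma enorm_ge0 n (v : 'cV[R]_n) : 0 <= enorm v.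
Proof. exact: sqrtr_ge0. Qed.

Lemma sqr_enorm v : enorm v ^+ 2 = v 0 0 ^+ 2 + v 1 0 ^+ 2 + v 2 0 ^+ 2.
Proof. by rewrite sqr_sqrtr ?sum3E // !addr_ge0 // sqr_ge0. Qed.

Lemma sqr_norm_so3 Y : norm_so3 Y ^+ 2 = Y 2 1 ^+ 2 + Y 0 2 ^+ 2 + Y 1 0 ^+ 2.
Proof. by rewrite sqr_enorm; have [-> -> ->] := vecE Y. Qed.

Lemma norm_so3_eq0 Y : so3 Y -> norm_so3 Y = 0 -> Y = 0.
Proof.
move=> /so3_entries[[y00 y11 y22] [y01 y20 y12]] Y0.
have := sqr_norm_so3 Y; rewrite Y0 expr0n/= => e0.
have [y21 y02 y10] : [/\ Y 2 1 = 0, Y 0 2 = 0 & Y 1 0 = 0].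
  by split; nra.
apply/matrixP => i j; rewrite mxE.
by have [->|->|->] := ord3P i; have [->|->|->] := ord3P j;
  rewrite ?y00 ?y11 ?y22 ?y01 ?y20 ?y12 ?y21 ?y02 ?y10 ?oppr0.
Qed.

Lemma so3_sqrE Y : so3 Y ->
  Y ^+ 2 = vec Y *m (vec Y)^T - (norm_so3 Y ^+ 2)%:M.
Proof.
move=> /so3_entries[[y00 y11 y22] [y01 y20 y12]].
rewrite sqr_norm_so3; apply/matrixP => i j; rewrite expr2 !mxE sum3E big_ord1 !mxE.
by have [->|->|->] := ord3P i; have [->|->|->] := ord3P j;
  rewrite /= ?y00 ?y11 ?y22 ?y01 ?y20 ?y12 ?mulr1n ?mulr0n; ring.
Qed.

(** The theorem of Cayley and Hamilton for so(3); it reduces every power of Y to a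
multiple of Y or of its square, which sums the exponential series. *)
Lemma so3_cube Y : so3 Y -> Y ^+ 3 = - norm_so3 Y ^+ 2 *: Y.
Proof.
move=> sY; have [[y00 y11 y22] [y01 y20 y12]] := so3_entries sY.
rewrite exprSr so3_sqrE // sqr_norm_so3.
apply/matrixP => i j; rewrite !mxE sum3E !mxE !big_ord1 !mxE.
by have [->|->|->] := ord3P i; have [->|->|->] := ord3P j;
  rewrite /= ?y00 ?y11 ?y22 ?y01 ?y20 ?y12 ?mulr1n ?mulr0n; ring.
Qed.

(** The rotation of angle t about the axis of Y, that is e^{tY/|Y|}; for
Y = 0 both correction terms vanish and it is the identity. *)
Definition rodrigues Y (t : R) : 'M[R]_3 :=
  1 + (sin t / norm_so3 Y) *: Y + ((1 - cos t) / norm_so3 Y ^+ 2) *: Y ^+ 2.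

(** The law of a one-parameter group.  Modulo the relation Y^3 = - |Y|^2 Y the claim is
the addition formulas for sin and cos. *)
Lemma rodriguesD Y (s t : R) : so3 Y ->
  rodrigues Y s * rodrigues Y t = rodrigues Y (s + t).
Proof.
move=> sY; have [/(norm_so3_eq0 sY) ->|th0] := eqVneq (norm_so3 Y) 0.
  by rewrite /rodrigues expr0n/= !scaler0 !addr0 mulr1.
have Y3 : Y * Y ^+ 2 = - norm_so3 Y ^+ 2 *: Y by rewrite -exprS so3_cube.
have Y3' : Y ^+ 2 * Y = - norm_so3 Y ^+ 2 *: Y by rewrite -exprSr so3_cube.
have Y4 : Y ^+ 2 * Y ^+ 2 = - norm_so3 Y ^+ 2 *: Y ^+ 2.
  by rewrite [X in X * _]expr2 -mulrA Y3 -scalerAr -expr2.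
rewrite /rodrigues.
rewrite !(mulrDl, mulrDr, mul1r, mulr1) -!(scalerAl, scalerAr) Y3 Y3' Y4.
rewrite -!expr2 sinD cosD.
move: (Y ^+ 2) (norm_so3 Y) th0 => Z th th0.
by apply/matrixP => i j; rewrite !mxE; field.
Qed.

Lemma rodrigues0 Y : rodrigues Y 0 = 1.
Proof. by rewrite /rodrigues sin0 cos0 subrr !mul0r !scale0r !addr0. Qed.

Lemma trmx_rodrigues Y (t : R) : so3 Y -> (rodrigues Y t)^T = rodrigues Y (- t).
Proof.
move=> sY; have YT : Y^T = - Y by [].
have YT2 : (Y ^+ 2)^T = Y ^+ 2.
  by rewrite expr2 -[X in X^T]/(Y *m Y) trmx_mul YT mulNmx mulmxN opprK.
rewrite /rodrigues sinN cosN !linearD/= !linearZ/= YT YT2 trmx1.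
by rewrite mulNr scaleNr scalerN.
Qed.

(** The transpose of the rotation of angle t is that of angle - t, whence orthogonality.
Being the square of the orthogonal rotation of angle t/2, it has determinant 1. *)
Lemma rodrigues_SO3 Y (t : R) : so3 Y -> SO3 (rodrigues Y t).
Proof.
move=> sY; have orth s : (rodrigues Y s)^T *m rodrigues Y s = 1%:M.
  rewrite trmx_rodrigues // -[LHS]/(rodrigues Y (- s) * rodrigues Y s).
  by rewrite rodriguesD // addNr rodrigues0.
split; first exact: orth.
have -> : t = t / 2 + t / 2 by lra.
rewrite -rodriguesD // det_mulmx -[X in X * _]det_tr -det_mulmx.
by rewrite orth det1.
Qed.

(** Writes the constant term of the exponential as a term of the cosine series at 0, so
that the exponential is a combination of sine and cosine series only. *)
Lemma cos_coeff0E n : cos_coeff (0 : R) n = (n == 0)%:R.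
Proof.
case: n => [|n]; rewrite /cos_coeff /=.
  by rewrite expr0z expr0 fact0 !mul1r invr1.
by rewrite expr0n /= mulr0 mul0r.
Qed.

(** By [so3_cube] the odd powers of Y are multiples of Y and the even ones of its square,
with coefficients (- |Y|^2)^k: up to powers of |Y|, the signs of the sine and cosine
series. *)
Lemma expm_term Y n : so3 Y -> (n`!%:R)^-1 *: Y ^+ n =
  cos_coeff 0 n *: 1 + (sin_coeff (norm_so3 Y) n / norm_so3 Y) *: Y +
  ((cos_coeff 0 n - cos_coeff (norm_so3 Y) n) / norm_so3 Y ^+ 2) *: Y ^+ 2.
Proof.
move=> sY; rewrite cos_coeff0E.
have [/(norm_so3_eq0 sY) ->|th0] := eqVneq (norm_so3 Y) 0.
  rewrite !expr0n/= !scaler0 !addr0.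
  by case: n => [|n] /=; rewrite ?fact0 ?invr1 ?scaler0 ?scale0r.
have powY k : Y ^+ k.*2.+1 = (- norm_so3 Y ^+ 2) ^+ k *: Y /\
              Y ^+ k.*2.+2 = (- norm_so3 Y ^+ 2) ^+ k *: Y ^+ 2.
  elim: k => [|k [IH1 IH2]]; first by rewrite !expr0 !scale1r expr1.
  have e3 : Y ^+ k.+1.*2.+1 = (- norm_so3 Y ^+ 2) ^+ k.+1 *: Y.
    by rewrite doubleS exprSr IH2 -scalerAl -exprSr so3_cube // scalerA -exprSr.
  by split; rewrite // exprSr e3 -scalerAl -expr2.
case: n => [|n].
  rewrite /sin_coeff /cos_coeff /= expr0z expr0 fact0 !mul0r !mul1r invr1 subrr.
  by rewrite !mul0r !scale0r !addr0.
rewrite scale0r add0r sub0r.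
rewrite -(odd_double_half n); case: (odd n); rewrite /= ?add0n ?add1n.
  rewrite (powY _).2 /sin_coeff /cos_coeff /= negbK odd_double /=.
  rewrite -doubleS doubleK !mul0r scale0r add0r scalerA; congr (_ *: _).
  rewrite -exprnP -mul2n !exprM [in LHS]exprNn !exprSr; field.
  by rewrite th0 pnatr_eq0 -lt0n fact_gt0.
rewrite (powY _).1 /sin_coeff /cos_coeff /= odd_double /= doubleK.
rewrite !mul0r oppr0 mul0r scale0r addr0 scalerA; congr (_ *: _).
rewrite -mul2n [_ ^+ (2 * _).+1]exprSr exprM [in LHS]exprNn; field.
by rewrite th0 pnatr_eq0 -lt0n fact_gt0.
Qed.

Lemma expmE Y : so3 Y -> expm Y = rodrigues Y (norm_so3 Y).
Proof.
move=> sY; rewrite /expm.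
set th := norm_so3 Y.
have -> : series (fun n => (n`!%:R)^-1 *: Y ^+ n) = (fun n =>
    series (cos_coeff 0) n *: 1 + (series (sin_coeff th) n / th) *: Y +
    ((series (cos_coeff 0) n - series (cos_coeff th) n) / th ^+ 2) *: Y ^+ 2).
  apply/funext => n; rewrite /series /=.
  under eq_bigr do rewrite expm_term // -/th.
  by rewrite !big_split /= -!scaler_suml sumrB.
apply: cvg_lim; first exact: norm_hausdorff.
have cvc x : series (cos_coeff x) @ \oo --> cos x.
  by rewrite unlock; exact: is_cvg_series_cos_coeff.
have cvs x : series (sin_coeff x) @ \oo --> sin x.
  by rewrite unlock; exact: is_cvg_series_sin_coeff.
have -> : rodrigues Y th = cos 0 *: 1 + (sin th / th) *: Y +
    ((cos 0 - cos th) / th ^+ 2) *: Y ^+ 2.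
  by rewrite /rodrigues cos0 scale1r.
apply: cvgD; first apply: cvgD; apply: cvgZr_tmp.
- exact: cvc.
- by apply: cvgMr_tmp; exact: cvs.
- by apply: cvgMr_tmp; apply: cvgB; exact: cvc.
Qed.

Lemma expm_SO3 Y : so3 Y -> SO3 (expm Y).
Proof. by move=> sY; rewrite expmE //; exact: rodrigues_SO3. Qed.

Lemma cos_lt1 (x : R) : 0 < x < 2 * pi -> cos x < 1.
Proof.
move=> /andP[x0 x2pi].
have s0 : 0 < sin (x / 2) by apply: sin_gt0_pi; apply/andP; split; lra.
have -> : x = x / 2 + x / 2 by lra.
rewrite cosD; have := cos2Dsin2 (x / 2); rewrite !expr2; nra.
Qed.

(** Equality of both coordinates gives cos (y - x) = 1, excluded for 0 < y - x < 2 pi. *)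
Lemma cos_sin_inj (x y : R) : 0 < x < 2 * pi -> 0 < y < 2 * pi ->
  cos x = cos y -> sin x = sin y -> x = y.
Proof.
wlog xy : x y / x < y => [th|] x2pi y2pi cxy sxy.
  have [xy|yx|//] := ltgtP x y; first exact: th.
  by symmetry; exact: th.
suff : cos (y - x) < 1.
  by rewrite cosB cxy sxy -!expr2 cos2Dsin2 ltxx.
by apply: cos_lt1; move: x2pi y2pi => /andP[? ?] /andP[? ?]; apply/andP; split; lra.
Qed.

(** The hemispheres are chosen such that each line through the origin meets the north
one exactly once: on the equator the north one keeps a half-open arc. *)
Lemma north_opp v : enorm v = 1 -> north (- v) <-> ~ north v.
Proof.
move=> v1; have := sqr_enorm v; rewrite v1 expr1n => e.
have Nv1 : enorm (- v) = 1.
  rewrite -v1 /enorm; congr Num.sqrt; apply: eq_bigr => i _.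
  by rewrite mxE sqrrN.
rewrite /north /= Nv1 v1 !mxE.
move: (v 0 0) (v 1 0) (v 2 0) e => x y z e; split.
  move=> [_ +] [_ +].
  move=> [z0|[z0 /andP[x0 x1] /andP[y0 y1]]] [z0'|[z0' /andP[x0' x1'] /andP[y0' y1']]]; nra.
move=> nv; split => //.
have [z0|z0|z0] := ltgtP z 0.
- by left; lra.
- by case: nv; split => //; left.
right; have {}nv : ~ (-1 <= x < 1 /\ 0 <= y <= 1).
  by move=> [? ?]; case: nv; split => //; right.
have [y0|y0|y0] := ltgtP y 0.
- by split; [lra| apply/andP; split; nra | apply/andP; split; nra].
- by case: nv; split; apply/andP; split; nra.
have [x0|x0] := ltP x 0; last by split; [lra| apply/andP; split; nra | apply/andP; split; nra].
by case: nv; split; apply/andP; split; nra.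
Qed.

Lemma vecZ (c : R) Y : vec (c *: Y) = c *: vec Y.
Proof.
by apply/matrixP => i j; rewrite !mxE; case: i => [[|[|[|//]]] ?] /=.
Qed.

Lemma norm_so3Z (c : R) Y : norm_so3 (c *: Y) = `|c| * norm_so3 Y.
Proof.
rewrite /norm_so3 vecZ /enorm -sqrtr_sqr -sqrtrM ?sqr_ge0 //; congr Num.sqrt.
by rewrite mulr_sumr; apply: eq_bigr => i _; rewrite mxE exprMn.
Qed.

Lemma enorm_unit_vec Y : norm_so3 Y != 0 -> enorm (unit_vec Y) = 1.
Proof.
move=> Y0; have := norm_so3Z (norm_so3 Y)^-1 Y.
rewrite {1}/norm_so3 vecZ -/(unit_vec Y) => ->.
by rewrite normfV ger0_norm ?enorm_ge0 // mulVf.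
Qed.

Lemma so3Z (c : R) Y : so3 Y -> so3 (c *: Y).
Proof. by rewrite /so3 /= linearZ /= => ->; rewrite scalerN. Qed.

(** Wrapping turns the axis n into - n and the angle theta into 2 pi - theta, so q(D)
is described by one condition on the angle and one on the axis. *)
Lemma qD_spec X0 Y : qD X0 Y -> so3 Y /\
  (Y = 0 \/ 0 < norm_so3 Y < 2 * pi /\
            same_hemisphere (unit_vec Y) (unit_vec X0)).
Proof.
have pi0 := pi_gt0 R.
move=> [W [sW Wpi] <-]; rewrite /qmap; case: asboolP => [[->|sh]|nsh].
- by rewrite /so3 /= trmx0 oppr0; split => //; left.
- split => //; have [/(norm_so3_eq0 sW)->|W0] := eqVneq (norm_so3 W) 0; first by left.
  right; split => //; rewrite lt_neqAle eq_sym W0 enorm_ge0 /=; lra.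
have W0 : norm_so3 W != 0.
  by apply/eqP => /(norm_so3_eq0 sW) W0; apply: nsh; left.
have W_gt0 : 0 < norm_so3 W by rewrite lt_neqAle eq_sym W0 enorm_ge0.
have c_lt0 : 1 - 2 * pi / norm_so3 W < 0.
  by rewrite subr_lt0 ltr_pdivlMr // mul1r; lra.
have nw : norm_so3 (Defs.wrap W) = 2 * pi - norm_so3 W.
  by rewrite /Defs.wrap norm_so3Z ltr0_norm //; field.
split; first exact: so3Z.
right; split; first by rewrite nw; apply/andP; split; lra.
have -> : unit_vec (Defs.wrap W) = - unit_vec W.
  transitivity (((2 * pi - norm_so3 W)^-1 * (1 - 2 * pi / norm_so3 W)) *: vec W).
    by rewrite /unit_vec nw /Defs.wrap vecZ scalerA.
  rewrite /unit_vec -[RHS]scaleNr; congr (_ *: _).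
  by field; rewrite W0; apply/eqP; lra.
have := north_opp (enorm_unit_vec W0); rewrite /same_hemisphere => nN.
have {}nsh : ~ same_hemisphere (unit_vec W) (unit_vec X0).
  by move=> h; apply: nsh; right.
rewrite nN; have [nW|nW] := pselect (north (unit_vec W));
  have [nX|nX] := pselect (north (unit_vec X0)); split => // _;
  by [exfalso; apply: nsh; split | ].
Qed.

Lemma expm_trace Y : so3 Y -> \tr (expm Y) = 1 + 2 * cos (norm_so3 Y).
Proof.
move=> sY; rewrite expmE //.
have [-> |th0] := eqVneq (norm_so3 Y) 0.
  by rewrite rodrigues0 mxtrace1 cos0; ring.
rewrite /rodrigues so3_sqrE //.
have [[y00 y11 y22] _] := so3_entries sY.
rewrite /mxtrace sum3E !mxE !big_ord1 !mxE /= y00 y11 y22.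
have := sqr_norm_so3 Y; move: (norm_so3 Y) th0 => th th0 e.
have -> : Y 2 1 * Y 2 1 = th ^+ 2 - Y 0 2 ^+ 2 - Y 1 0 ^+ 2 by rewrite e; ring.
by rewrite mulr1n; field.
Qed.

Lemma expm_sub_tr Y : so3 Y ->
  expm Y - (expm Y)^T = (2 * sin (norm_so3 Y) / norm_so3 Y) *: Y.
Proof.
move=> sY; rewrite expmE // trmx_rodrigues // /rodrigues sinN cosN.
by apply/matrixP => i j; rewrite !mxE; ring.
Qed.

Lemma expm_add_tr Y : so3 Y -> norm_so3 Y != 0 ->
  expm Y + (expm Y)^T = 2%:M +
    (2 * (1 - cos (norm_so3 Y))) *: (unit_vec Y *m (unit_vec Y)^T - 1).
Proof.
move=> sY Y0; rewrite expmE // trmx_rodrigues // /rodrigues sinN cosN so3_sqrE //.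
have -> : (2%:M : 'M[R]_3) = 1 + 1.
  by apply/matrixP => i j; rewrite !mxE mulr2n mulrnDl.
by apply/matrixP => i j; rewrite !mxE !big_ord1 !mxE -(mulr_natr (_ ^+ 2)); field.
Qed.

(** Equality in the inequality of Cauchy and Schwarz: the inner product s of v and w
satisfies s^2 = |v|^2 |v|^2 = 1. *)
Lemma enorm_outer_inj v w : enorm v = 1 -> enorm w = 1 ->
  v *m v^T = w *m w^T -> w = v \/ w = - v.
Proof.
move=> v1 w1 vw; have vwE i j : v i 0 * v j 0 = w i 0 * w j 0.
  by have /matrixP/(_ i j) := vw; rewrite !mxE !big_ord1 !mxE.
have := sqr_enorm v; have := sqr_enorm w; rewrite v1 w1 expr1n.
pose s := v 0 0 * w 0 0 + v 1 0 * w 1 0 + v 2 0 * w 2 0.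
move=> ew ev; have s2 : s ^+ 2 = 1.
  transitivity ((v 0 0 ^+ 2 + v 1 0 ^+ 2 + v 2 0 ^+ 2) ^+ 2); last first.
    by rewrite -ev expr1n.
  have -> : s ^+ 2 = \sum_i \sum_j (v i 0 * v j 0) * (w i 0 * w j 0).
    by rewrite !sum3E /s; ring.
  under eq_bigr do under eq_bigr do rewrite -vwE.
  by rewrite !sum3E; ring.
have eq0 (a b c : R) : a ^+ 2 + b ^+ 2 + c ^+ 2 = 0 -> [/\ a = 0, b = 0 & c = 0].
  by split; nra.
have /eqP := s2; rewrite sqrf_eq1 => /orP[] /eqP s1.
  left; have [] := eq0 (w 0 0 - v 0 0) (w 1 0 - v 1 0) (w 2 0 - v 2 0).
    by move: s1; rewrite /s; lra.
  move=> e0 e1 e2; apply/matrixP => i j; rewrite (ord1 j); apply/eqP.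
  by rewrite -subr_eq0; have [->|->|->] := ord3P i; apply/eqP.
right; have [] := eq0 (w 0 0 + v 0 0) (w 1 0 + v 1 0) (w 2 0 + v 2 0).
  by move: s1; rewrite /s; lra.
move=> e0 e1 e2; apply/matrixP => i j; rewrite (ord1 j) mxE; apply/eqP.
by rewrite -addr_eq0; have [->|->|->] := ord3P i; apply/eqP.
Qed.

Lemma vec_unit_vec Y : norm_so3 Y != 0 -> vec Y = norm_so3 Y *: unit_vec Y.
Proof. by move=> Y0; rewrite /unit_vec scalerA divff // scale1r. Qed.

Lemma vec_inj X Y : so3 X -> so3 Y -> vec X = vec Y -> X = Y.
Proof.
move=> sX sY XY; apply/eqP; rewrite -subr_eq0; apply/eqP; apply: norm_so3_eq0.
  by move: sX sY; rewrite /so3 /= linearB /= => -> ->; rewrite opprB opprK addrC.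
rewrite /norm_so3 /enorm big1 ?sqrtr0 // => i _.
have /matrixP/(_ i 0) := XY; rewrite !mxE.
by case: i => [[|[|[|//]]] ?] /= ->; rewrite subrr expr0n.
Qed.

(** The trace gives cos theta, which is 1 only for Y = 0; the symmetric part gives the
axis up to sign, the hemisphere removes the sign, and the antisymmetric part then gives
sin theta. *)
Lemma expm_qD_inj X0 Y W : qD X0 Y -> qD X0 W -> expm Y = expm W -> Y = W.
Proof.
move=> /qD_spec[sY hY] /qD_spec[sW hW] YW.
have cYW : cos (norm_so3 Y) = cos (norm_so3 W).
  by have := expm_trace sY; rewrite YW expm_trace //; lra.
have norm0 : norm_so3 (0 : 'M[R]_3) = 0.
  by rewrite -(scale0r (0 : 'M[R]_3)) norm_so3Z normr0 mul0r.
move: hY hW => [Y0|[thY hemY]] [W0|[thW hemW]].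
- by rewrite Y0 W0.
- by have := cos_lt1 thW; rewrite -cYW Y0 norm0 cos0 ltxx.
- by have := cos_lt1 thY; rewrite cYW W0 norm0 cos0 ltxx.
have pos (Z : 'M[R]_3) : 0 < norm_so3 Z < 2 * pi -> norm_so3 Z != 0.
  by move=> /andP[Z0 _]; rewrite gt_eqF.
have Y0 := pos _ thY; have W0 := pos _ thW.
have cY : 2 * (1 - cos (norm_so3 Y)) != 0.
  by rewrite mulf_neq0 // subr_eq0 gt_eqF // cos_lt1.
have nn : unit_vec Y *m (unit_vec Y)^T = unit_vec W *m (unit_vec W)^T.
  have := expm_add_tr sY Y0; rewrite YW expm_add_tr // -cYW.
  by move=> /addrI/(scalerI cY)/addIr.
have nY := enorm_unit_vec Y0; have nW := enorm_unit_vec W0.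
have nE : unit_vec W = unit_vec Y.
  have [//|WN] := enorm_outer_inj nY nW nn.
  have := north_opp nY; rewrite -WN; move: hemY hemW; rewrite /same_hemisphere.
  by tauto.
have sYW : sin (norm_so3 Y) = sin (norm_so3 W).
  have sE (Z : 'M[R]_3) : so3 Z -> norm_so3 Z != 0 ->
      vec (expm Z - (expm Z)^T) = (2 * sin (norm_so3 Z)) *: unit_vec Z.
    by move=> sZ Z0; rewrite expm_sub_tr // vecZ /unit_vec scalerA.
  have := sE _ sY Y0; rewrite YW sE // nE => e.
  have u0 : unit_vec Y != 0.
    apply/eqP => u0; move: nY; rewrite u0 /enorm big1 ?sqrtr0.
      by move=> /eqP; rewrite eq_sym oner_eq0.
    by move=> i _; rewrite mxE expr0n.
  move/eqP: e; rewrite -subr_eq0 -scalerBl scaler_eq0 (negbTE u0) orbF subr_eq0.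
  by move=> /eqP; lra.
apply: vec_inj => //; rewrite !vec_unit_vec // nE; congr (_ *: _).
exact: cos_sin_inj.
Qed.

End Rotations.

(** * Smoothness of the branch and its relative period *)

Lemma Cm_open_preimage (R : realType) m (E F : normedModType R) (U : set E)
    (W : set F) (f : E -> F) :
  open U -> Cm m U f -> open W -> open (U `&` f @^-1` W).
Proof.
move=> oU Cf oW; rewrite openE => x [Ux Wfx]; apply: filterI.
  exact: open_nbhs_nbhs.
by apply: (Cm_continuous Cf Ux); exact: open_nbhs_nbhs.
Qed.

Lemma sqrt_eps_dom (R : realType) (lam lam0 : R) :
  0 <= lam < lam0 -> eps_dom lam0 (Num.sqrt lam).
Proof.
move=> /andP[l0 ll0]; split; first exact: sqrtr_ge0.
by rewrite ltr_sqrt //; exact: le_lt_trans ll0.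
Qed.

Lemma eps_dom_sqr (R : realType) (eps lam0 : R) :
  eps_dom lam0 eps -> 0 <= eps ^+ 2 < lam0.
Proof.
move=> [e0 elam]; rewrite sqr_ge0 /= -(ger0_norm e0) in elam *.
have lam0_gt0 : 0 < lam0 by rewrite -sqrtr_gt0; exact: le_lt_trans elam.
rewrite real_normK ?num_real // -(sqr_sqrtr (ltW lam0_gt0)).
by rewrite ltr_pXn2r ?nnegrE ?sqrtr_ge0 // -(ger0_norm e0).
Qed.

(** A local lift of Z near (T, eps) composed with eps |-> (T(eps^2), eps) is a local lift
of the branch. *)
Lemma CS1_qD_period (R : realType) (m : nat) (X0 : 'M[R]_3) (lam0 lam1 lam2 : R)
    (om : R -> R) (Z : R -> R -> 'M[R]_3) (f : R -> 'M[R]_3) :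
  lam2 <= lam1 <= lam0 ->
  (forall lam, 0 <= lam < lam0 -> om lam != 0) ->
  CS1 m lam0 om -> CS_qD m X0 [set t : R | 0 <= t] lam1 Z ->
  (forall lam, 0 <= lam < lam2 -> f lam = Z (period_of om lam) lam) ->
  CS1_qD m X0 lam2 f.
Proof.
move=> /andP[l21 l10] om0 Com [ZD CZ] fZ.
have dom_sub (a b e : R) : a <= b -> eps_dom a e -> eps_dom b e.
  by move=> ab [e0 ea]; split => //; exact: lt_le_trans (ler_wsqrtr ab).
have per_dom (x : R) : eps_dom lam2 x ->
    ([set t : R | 0 <= t] `*` eps_dom lam1) (period_of om (x ^+ 2), x).
  move=> x2; split; last exact: dom_sub x2.
  by rewrite /= /period_of divr_ge0 // mulr_ge0 // pi_ge0.
split=> [x x2|x x2].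
  by rewrite fZ ?eps_dom_sqr //; exact: ZD _ (per_dom _ x2).
have x0 : eps_dom lam0 x by apply: dom_sub x2; exact: le_trans l10.
have [V [h [oV Vx Ch hom]]] := Com x x0.
have [U [g [oU Up Cg gZ]]] := CZ _ (per_dom _ x2).
have hx0 : h x != 0 by rewrite -hom // om0 // eps_dom_sqr.
(* The sign of om is constant near x, which makes the absolute value smooth. *)
have [s ss shx] : exists2 s : R, s * s = 1 & 0 < s * h x.
  have [hx|hx|hx] := ltgtP (h x) 0; last by rewrite hx eqxx in hx0.
  - by exists (-1); rewrite ?mulrNN ?mul1r ?mulN1r ?oppr_gt0.
  - by exists 1; rewrite ?mul1r.
pose V0 := V `&` (fun y => s * h y) @^-1` [set z | 0 < z].
have CshV : Cm m V (fun y => s * h y) by apply: CmM => //; exact: Cm_cst.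
have oV0 : open V0.
  by apply: (Cm_open_preimage oV CshV); exact: open_gt.
have V0V : V0 `<=` V by move=> y [].
have V0n y : V0 y -> s * h y != 0 by move=> [_ /lt0r_neq0].
pose k y : R * R := (2 * pi * (s * h y)^-1, y).
have Ck : Cm m V0 k.
  apply: Cm_pair => //; last exact: Cm_id.
  apply: CmM => //; first exact: Cm_cst.
  by apply: Cm_inv => //; exact: Cm_subset CshV.
have kE y : V0 y -> eps_dom lam2 y -> k y = (period_of om (y ^+ 2), y).
  move=> [Vy sy] y2; rewrite /k /period_of.
  rewrite hom //; last by apply: dom_sub y2; exact: le_trans l10.
  have -> // : `|h y| = s * h y.
  have s1 : `|s| = 1.
    have := congr1 Num.norm ss; rewrite normrM normr1 => /eqP.
    by rewrite -expr2 sqrp_eq1 // => /eqP.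
  by rewrite -(gtr0_norm sy) normrM s1 mul1r.
have V0x : V0 x by split.
exists (V0 `&` k @^-1` U), (g \o k); split.
- exact: (Cm_open_preimage oV0 Ck oU).
- by split => //=; rewrite kE.
- apply: (Cm_comp (V := U)) => //.
  + exact: (Cm_open_preimage oV0 Ck oU).
  + by move=> y [].
  + by apply: Cm_subset Ck => y [].
- move=> y [V0y Uky] y2.
  rewrite fZ ?eps_dom_sqr //= kE //.
  by apply: (gZ _ _ (per_dom _ y2)); rewrite -kE.
Qed.

Lemma SO3M (R : realType) (A B : 'M[R]_3) : SO3 A -> SO3 B -> SO3 (A *m B).
Proof.
move=> [A1 dA] [B1 dB]; split; last by rewrite det_mulmx dA dB mulr1.
by rewrite trmx_mul mulmxA -(mulmxA B^T) A1 mulmx1.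
Qed.

(** Only the minimality of the period T of q needs an argument: an earlier return to the
group orbit is carried along the whole solution by equivariance, and would be a smaller
period of q by injectivity of the chart. *)
Lemma relative_period_branch (R : realType) (N : nat) (r : R) (d : 'I_N -> R)
    (F : 'cV[R]_N -> R -> 'cV[R]_N) (Ya : normedModType R)
    (repYa : Ya -> 'cV[R]_3 -> 'cV[R]_N) (act : 'M[R]_3 -> Ya -> Ya)
    (dom : R -> Ya -> R -> Prop) (Phi : R -> Ya -> R -> Ya) (M : nat)
    (lam T : R) (A : R -> 'M[R]_3) (q : R -> 'rV[R]_2) (Psi : 'rV[R]_2 -> Ya) :
  rotation_action r repYa act -> rd_semiflow r d F repYa dom Phi M ->
  equivariant act dom Phi ->
  (forall t, 0 <= t -> [/\ SO3 (A t), dom t (Psi (q 0)) lam &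
     Phi t (Psi (q 0)) lam = act (A t) (Psi (q t))]) ->
  (forall B C p p', SO3 B -> SO3 C -> act B (Psi p) = act C (Psi p') ->
     B = C /\ p = p') ->
  0 < T -> q T = q 0 ->
  (forall s, 0 < s < T -> exists2 t, 0 <= t & q (t + s) <> q t) ->
  relative_period act dom Phi (Psi (q 0)) lam T.
Proof.
move=> [_ actM _] hPhi hequiv sol inj T0 qT qmin.
have [sAT domT PhiT] := sol T (ltW T0).
split => //; first by split => //; exists (A T) => //; rewrite PhiT qT.
move=> s sT [domsu [B sB Phis]].
have [t t0 qts] := qmin s sT; have /andP[s0 _] := sT.
have [sAts domts Phits] := sol (t + s) (addr_ge0 t0 (ltW s0)).
have [sAt domt Phit] := sol t t0.
have [_ /(_ domts) PhiD] := sf_add hPhi t0 domsu.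
have [_ /(_ domt) PhiB] := hequiv B sB t (Psi (q 0)) lam.
apply: qts; apply: (proj2 (inj (A (t + s)) (B *m A t) _ _ _ _ _)) => //.
  exact: SO3M.
by rewrite -Phits PhiD Phis PhiB Phit actM.
Qed.

Lemma relative_period_unique (R : realType) (Ya : normedModType R)
    (act : 'M[R]_3 -> Ya -> Ya)
    (dom : R -> Ya -> R -> Prop) (Phi : R -> Ya -> R -> Ya) (u : Ya) (lam T T' : R) :
  relative_period act dom Phi u lam T -> relative_period act dom Phi u lam T' ->
  T = T'.
Proof.
move=> [T0 bT lT] [T0' bT' lT']; have [TT'|TT'|//] := ltgtP T T'.
- by case: (lT' T); rewrite ?T0.
- by case: (lT T'); rewrite ?T0'.
Qed.

Lemma diffeo_on_inj (R : realType) m (E F : normedModType R) (S : set E) (S' : set F)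
  (f : E -> F) : diffeo_on m S S' f -> forall x y, S x -> S y -> f x = f y -> x = y.
Proof.
by move=> [g [gf _ _ _]] x y /gf[_ gx] /gf[_ gy] fxy; rewrite -gx fxy gy.
Qed.

Lemma half_open_pinfty (R : realType) : half_open +oo%E = [set t : R | 0 <= t].
Proof. by apply/seteqP; split => t /= => [[]|] //; split => //; exact: ltry. Qed.

(** * The branch of primary frequency vectors *)

Unset Implicit Arguments.
Set Strict Implicit.

(* Sufficiently smooth: for each m >= 1 there is M such that the conclusion holds
   in class C^m if the data are of class C^M. *)
Theorem proposition5p7 (R : realType) (m : nat) (hm : (1 <= m)%N) :
  exists M : nat, (m <= M)%N /\
  forall (* the equation *)
    (N : nat) (hN : (1 <= N)%N)
    (r : R) (hr : 0 < r)
    (d : 'I_N -> R) (hd : forall i, 0 <= d i)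
    (k : option nat) (hk : if k is Some k' then (3 <= k')%N else true)
    (hMk : if k is Some k' then (M <= k')%N else true)
    (F : 'cV[R]_N -> R -> 'cV[R]_N)
    (hF : Cclass (omap (addn 2) k) setT (fun p : 'cV[R]_N * R => F p.1 p.2))
    (hF0 : forall lam, F 0 lam = 0)
    (* the spaces Y and Y^alpha, the action of SO(3), the semiflow *)
    (e : nat -> 'cV[R]_3 -> R) (ev : nat -> R) (he : eigenbasis r e ev)
    (alpha : R) (halpha : 2^-1 < alpha < 1)
    (Y Ya : completeNormedModType R)
    (repY : Y -> 'cV[R]_3 -> 'cV[R]_N) (repYa : Ya -> 'cV[R]_3 -> 'cV[R]_N)
    (hY : fspace r e (weightY ev d) repY)
    (hYa : fspace r e (weightYa ev d alpha) repYa)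
    (inc : Ya -> Y)
    (hinc : forall u, sph_ae r (fun x => repY (inc u) x = repYa u x))
    (act : 'M[R]_3 -> Ya -> Ya) (hact : rotation_action r repYa act)
    (dom : R -> Ya -> R -> Prop) (Phi : R -> Ya -> R -> Ya)
    (hPhi : rd_semiflow r d F repYa dom Phi M)
    (hequiv : equivariant act dom Phi)
    (* the relative equilibrium *)
    (u0 : Ya) (X0 : 'M[R]_3)
    (hiso : trivial_isotropy act u0)
    (hrel : relative_equilibrium act dom Phi u0 X0 0)
    (hneq : ~ equilibrium dom Phi u0 0)
    (hX0 : X0 <> 0)
    (* the spectral assumptions *)
    (L : Y -> Y -> Prop) (hL : L = linearisation r d F repY repYa u0 X0)
    (sigma_star : set (R * R))
    (hsigma : sigma_star = spectrum L setT `&` [set z | 0 <= z.1])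
    (hspec : spectral_set L sigma_star)
    (P : Y -> Y) (hP : spectral_projection L sigma_star P)
    (hdim : exists b : 'I_5 -> Y, is_basis b (range_proj P))
    (S : R -> Y -> Y) (hS : c0_semigroup L S)
    (hdecay : exists C beta0 : R, [/\ 0 < C, 0 < beta0 &
       forall t : R, 0 <= t -> forall y, ker_proj P y ->
         `|S t y| <= C * expR (- (beta0 * t)) * `|y|])
    (* the center manifold reduction *)
    (b : 'I_2 -> Y)
    (hV : is_basis b [set y | range_proj P y /\ forall z,
       orbit_tangent act inc u0 z ->
         wdot r e (weightY ev d) (repY y) (repY z) = 0])
    (Mcu : R -> set Ya) (Psi : 'rV[R]_2 -> R -> Ya)
    (XG : 'rV[R]_2 -> R -> 'M[R]_3) (XN : 'rV[R]_2 -> R -> 'rV[R]_2)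
    (hcm : center_manifold act inc dom Phi M u0 X0 P Mcu Psi XG XN)
    (* the Hopf bifurcation *)
    (alphaH betaH : R -> R) (ombif lam0 : R) (q rr : R -> R -> 'rV[R]_2)
    (om : R -> R)
    (hHopf : hopf_bifurcation M XN alphaH betaH ombif lam0 q rr om)
    (* A(t, lam) and Z(t, lam) *)
    (lam1 : R) (hlam1 : 0 < lam1 <= lam0)
    (A : R -> R -> 'M[R]_3)
    (hA : forall lam : R, 0 <= lam < lam1 ->
       ode_solution +oo%E (A^~ lam) (fun t B => B *m XGt XG X0 q t lam) /\
       A 0 lam = 1%:M)
    (Z : R -> R -> 'M[R]_3)
    (hZ : CS_qD m X0 [set t : R | 0 <= t] lam1 Z)
    (hAZ : forall t lam : R, 0 <= t -> 0 <= lam < lam1 ->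
       A t lam = expm (Z t lam)),
  let u lam := Psi (q 0 lam) lam in
  let X lam := (`|om lam| / (2 * pi)) *: Z (period_of om lam) lam in
  (exists2 lam2 : R, 0 < lam2 &
     frequency_branch act dom Phi m u0 X0 u om ombif lam2 X) /\
  (forall (X' : R -> 'M[R]_3) (lam2 : R), 0 < lam2 ->
     frequency_branch act dom Phi m u0 X0 u om ombif lam2 X' ->
     exists2 lam3 : R, 0 < lam3 &
       forall lam : R, 0 <= lam < lam3 -> X' lam = X lam).
Proof.
exists m; split => //.
move=> N _ r _ d _ k _ _ F _ _ e ev _ alpha _ Y Ya repY repYa _ _ inc _ act hact.
move=> dom Phi hPhi hequiv u0 X0 _ _ _ _ L _ sigma_star _ _ P _ _ S _ _ b _.
move=> Mcu Psi XG XN hcm alphaH betaH ombif lam0 q rr om hHopf lam1.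
move=> /andP[lam1_gt0 lam10] A hA Z hZ hAZ u X.
have pi0 := pi_gt0 R; have [act1 _ _] := hact.
have [delta delta0 hred] := cm_reduction hcm.
have [C hC] := hb_q_O hHopf.
have om_neq0 lam : 0 <= lam < lam1 -> om lam != 0.
  move=> /andP[l0 l1]; apply: (hb_om_neq0 hHopf); rewrite l0 /=.
  exact: lt_le_trans lam10.
have T_gt0 lam : 0 <= lam < lam1 -> 0 < period_of om lam.
  by move=> /om_neq0 o0; rewrite /period_of divr_gt0 ?normr_gt0 // mulr_gt0.
have om_0 : om 0 = ombif.
  have [K hK] := hb_om_O hHopf.
  have := hK 0; rewrite lexx (lt_le_trans lam1_gt0 lam10) mulr0 => /(_ isT).
  by rewrite normr_le0 subr_eq0 => /eqP.
have ZD t lam : 0 <= t -> 0 <= lam < lam1 -> qD X0 (Z t lam).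
  move=> t0 hl; have := hZ.1 (t, Num.sqrt lam).
  rewrite /= sqr_sqrtr; last by case/andP: hl.
  by apply; split => //; exact: sqrt_eps_dom.
have TX lam : 0 <= lam < lam1 -> period_of om lam *: X lam = Z (period_of om lam) lam.
  move=> hl; rewrite /X scalerA /period_of.
  have o0 : `|om lam| != 0 by rewrite normr_eq0 om_neq0.
  rewrite mulrA divfK // divff ?scale1r //.
  by rewrite gt_eqF // mulr_gt0.
have A_SO3 t lam : 0 <= t -> 0 <= lam < lam1 -> SO3 (A t lam).
  move=> t0 hl; rewrite hAZ //; apply: expm_SO3.
  by have [] := qD_spec (ZD t lam t0 hl).
(* For lam below lam2 the periodic orbit stays in the domain of the reduction. *)
pose lam2 := Num.min lam1 (Num.min delta ((delta / (`|C| + 1)) ^+ 2)).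
have C1 : 0 < `|C| + 1 by rewrite ltr_wpDl.
have lam2_gt0 : 0 < lam2.
  by rewrite !lt_min lam1_gt0 delta0 exprn_gt0 // divr_gt0.
have lam2P lam : 0 <= lam < lam2 -> [/\ 0 <= lam < lam1, `|lam| < delta &
    Num.sqrt lam < delta / (`|C| + 1)].
  move=> /andP[l0]; rewrite !lt_min => /and3P[l1 ld lC].
  rewrite l0 l1 ger0_norm //; split => //.
  rewrite -(ger0_norm (ltW (divr_gt0 delta0 C1))) -sqrtr_sqr ltr_sqrt //.
  exact: le_lt_trans lC.
have inj lam : 0 <= lam < lam2 -> forall B D p p', SO3 B -> SO3 D ->
    act B (Psi p lam) = act D (Psi p' lam) -> B = D /\ p = p'.
  move=> /lam2P[_ ld _] B D p p' sB sD BD; have [hdif _ _] := hred lam ld.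
  by have [-> ->] := diffeo_on_inj (x := (B, p)) (y := (D, p')) hdif sB sD BD.
have sol lam : 0 < lam < lam2 -> forall t, 0 <= t ->
    [/\ SO3 (A t lam), dom t (u lam) lam &
        Phi t (u lam) lam = act (A t lam) (Psi (q t lam) lam)].
  move=> /andP[l0 l2] t t0; have hl : 0 <= lam < lam2 by rewrite ltW.
  have [hl1 ld lC] := lam2P _ hl; have [_ red _] := hred lam ld.
  have [odeA A0] := hA lam hl1.
  have hl0 : 0 < lam < lam0.
    by rewrite l0; case/andP: hl1 => _ /lt_le_trans; exact.
  have [|||s||domu Phiu] := red +oo%E (A^~ lam) (q^~ lam) _ _ _ _ t.
  - exact: ltry.
  - by move: odeA; rewrite /XGt l0.
  - exact: (hb_solution hHopf hl0).
  - rewrite half_open_pinfty /= => s0; split; first exact: A_SO3 s0 hl1.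
    apply: le_lt_trans (hC s lam s0 _) _; first by case/andP: hl0 => /ltW -> ->.
    have sq0 := sqrtr_ge0 lam.
    apply: (@le_lt_trans _ _ ((`|C| + 1) * Num.sqrt lam)).
      by apply: ler_wpM2r => //; rewrite (le_trans (ler_norm C)) // lerDl.
    by rewrite mulrC -ltr_pdivlMr.
  - by rewrite half_open_pinfty.
  by move: domu Phiu; rewrite A0 act1; split => //; exact: A_SO3 t0 hl1.
have rper lam : 0 < lam < lam2 ->
    relative_period act dom Phi (u lam) lam (period_of om lam).
  move=> hl; have /andP[l0 l2] := hl; have hl' : 0 <= lam < lam2 by rewrite ltW.
  have [hl1 _ _] := lam2P _ hl'.
  have hl0 : 0 < lam < lam0.
    by rewrite l0; case/andP: hl1 => _ /lt_le_trans; exact.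
  apply: (relative_period_branch (q := q^~ lam) (Psi := Psi^~ lam)
    hact hPhi hequiv (sol lam hl) (inj lam hl')).
  - exact: T_gt0.
  - by have := hb_period hHopf hl0 (lexx 0); rewrite add0r.
  - exact: hb_minimal hHopf _ hl0.
have PhiT lam : 0 < lam < lam2 ->
    Phi (period_of om lam) (u lam) lam = act (expm (period_of om lam *: X lam)) (u lam).
  move=> hl; have /andP[l0 l2] := hl; have hl' : 0 <= lam < lam2 by rewrite ltW.
  have [hl1 _ _] := lam2P _ hl'; have T0 := T_gt0 _ hl1.
  have [_ _ ->] := sol lam hl _ (ltW T0); rewrite TX // -hAZ //; last exact: ltW.
  have hl0 : 0 < lam < lam0.
    by rewrite l0; case/andP: hl1 => _ /lt_le_trans; exact.
  by have := hb_period hHopf hl0 (lexx 0); rewrite add0r /u => ->.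
have hz2 : 0 <= (0 : R) < lam2 by apply/andP; split.
have [hz1 zd _] := lam2P _ hz2.
have Psi0 : Psi 0 0 = u0 := cm_base hcm.
(* At lam = 0 the reduction is applied to the equilibrium q = 0, where X_G is X_0. *)
have Phi0 : Phi (2 * pi / `|ombif|) u0 0 =
    act (expm ((2 * pi / `|ombif|) *: X 0)) u0.
  rewrite -om_0 -/(period_of om 0) TX //.
  have T0 := T_gt0 _ hz1; rewrite -hAZ //; last exact: ltW.
  have [_ red _] := hred 0 zd; have [odeA A0] := hA 0 hz1.
  have [|||s||_ Phiu] := red +oo%E (A^~ 0) (fun=> 0) _ _ _ _ (period_of om 0).
  - exact: ltry.
  - by move: odeA; rewrite /XGt ltxx (cm_XG0 hcm).
  - split; first by move=> x; exact: cst_continuous.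
    by move=> t _ _; rewrite (cm_XN0 hcm); exact: is_derive_cst.
  - by rewrite half_open_pinfty /= normr0 => s0; split => //; exact: A_SO3 s0 hz1.
  - by rewrite half_open_pinfty /= ltW.
  by move: Phiu; rewrite A0 act1 Psi0.
split.
  exists lam2 => //; split.
  - apply: (CS1_qD_period (lam0 := lam0) (lam1 := lam1) (om := om) (Z := Z)) => //.
    + by rewrite lam10 andbT /lam2 ge_min lexx.
    + exact: hb_om_neq0 hHopf.
    + exact: hb_om_CS hHopf.
    + by move=> lam /lam2P[hl _ _]; exact: TX.
  - move=> lam /lam2P[hl _ _]; rewrite TX //; apply: ZD => //.
    by rewrite ltW // T_gt0.
  - move=> lam hl; split; last by exists (period_of om lam); [exact: rper|exact: PhiT].
    have hl' : 0 <= lam < lam2 by case/andP: hl => /ltW -> ->.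
    have [hl1 _ _] := lam2P _ hl'.
    have [sZ _] := qD_spec (ZD _ _ (ltW (T_gt0 _ hl1)) hl1).
    exact: so3Z.
  - exact: Phi0.
move=> X' lam2' lam2'_gt0 hX'; exists (Num.min lam2 lam2').
  by rewrite lt_min lam2_gt0.
move=> lam /andP[l0]; rewrite lt_min => /andP[l2 l2'].
have hl : 0 <= lam < lam2 by rewrite l0.
have [hl1 _ _] := lam2P _ hl.
have qX' : qD X0 (period_of om lam *: X' lam) by apply: (fb_qD hX'); rewrite l0.
have qX : qD X0 (period_of om lam *: X lam).
  by rewrite TX //; apply: ZD => //; rewrite ltW // T_gt0.
have E1 := expm_SO3 (proj1 (qD_spec qX')).
have E2 := expm_SO3 (proj1 (qD_spec qX)).
apply: (@scalerI _ _ (period_of om lam)); first by rewrite gt_eqF // T_gt0.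
apply: (expm_qD_inj qX' qX).
have [lz|lz] := eqVneq lam 0.
  rewrite lz in E1 E2 *.
  have := fb_zero hX'; rewrite Phi0 -om_0 -/(period_of om 0) -Psi0 => e12.
  by have [] := inj 0 hz2 _ _ _ _ E2 E1 e12.
have lgt0 : 0 < lam by rewrite lt_neqAle eq_sym lz.
have hl2 : 0 < lam < lam2 by rewrite lgt0.
have [_ [T rT PhiT']] : primary_frequency act dom Phi (u lam) lam (X' lam).
  by apply: (fb_primary hX'); rewrite lgt0.
have TE := relative_period_unique rT (rper lam hl2).
rewrite TE PhiT // in PhiT'.
by have [] := inj lam hl _ _ _ _ E2 E1 PhiT'.
Qed.
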